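(* Let $g:\mathbb{R}^m\to\overline{\mathbb{R}}$ be a polyhedral function and $(\bar z,\bar\lambda)\in\mathrm{gph}\,\partial g$. The following are equivalent: (a) $\bar\lambda\in\mathrm{ri}\,\partial g(\bar z)$; (b) for every $r>0$, the Moreau envelope $e_r g$ is $\mathcal{C}^2$ in a neighborhood of $\bar z+r\bar\lambda$; (c) for every $r>0$, the proximal mapping $\mathrm{prox}_{rg}$ is $\mathcal{C}^1$ in a neighborhood of $\bar z+r\bar\lambda$. Furthermore, if $\bar\lambda\in\mathrm{ri}\,\partial g(\bar z)$ and $r>0$, then for all $x$ sufficiently close to $\bar z+r\bar\lambda$, $$\nabla(\mathrm{prox}_{rg})(x)=P_{K_g(\bar z,\bar\lambda)}\quad\text{and}\quad\nabla^2(e_r g)(x)=\frac1r\big(I-P_{K_g(\bar z,\bar\lambda)}\big)=\frac1r P_{K_{g^*}(\bar\lambda,\bar z)}.$$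
   Context: A proper function $g:\mathbb{R}^m\to\overline{\mathbb{R}}$ is polyhedral if its epigraph is a polyhedral convex set; $\partial$ is the convex-analysis subdifferential; $\mathrm{ri}$ is relative interior; $g^*$ is the Fenchel conjugate (also polyhedral). For $z$ with $g(z)$ finite, ${\rm d} g(z)(w)=\liminf_{t\searrow 0,\,w'\to w}\frac{g(z+tw')-g(z)}{t}$ and for $\lambda\in\partial g(z)$ the critical cone is $K_g(z,\lambda)=\{w\mid\langle\lambda,w\rangle={\rm d} g(z)(w)\}$; analogously for $g^*$. $e_r g(x)=\inf_w\{g(w)+\frac1{2r}\|w-x\|^2\}$, $\mathrm{prox}_{rg}(x)=\mathrm{argmin}_w\{g(w)+\frac1{2r}\|w-x\|^2\}$. $P_K$ is the (Euclidean) projection onto $K$, here a linear map since $K$ is a subspace; $I$ is the identity matrix. *)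

(* Defs.v *)
From HB Require Import structures.
From mathcomp Require Import all_boot all_order all_algebra.
From mathcomp Require Import all_classical all_reals all_analysis.
Set Implicit Arguments. Unset Strict Implicit. Unset Printing Implicit Defensive.
Import Order.TTheory GRing.Theory Num.Theory.
Import numFieldNormedType.Exports.
Local Open Scope classical_set_scope.
Local Open Scope ring_scope.

Section Defs.
Variables (R : realType) (m : nat).
Notation V := 'rV[R]_m.

Definition dotp (u v : V) : R := \sum_(i < m) u ord0 i * v ord0 i.
Definition sqnorm (u : V) : R := dotp u u.

Definition proper_fun (g : V -> \bar R) : Prop :=
  (forall x, g x != -oo%E) /\ (exists x, g x \is a fin_num).

Definition polyhedral_set_prod (S : set (V * R)) : Prop :=
  exists (k : nat) (p : 'I_k -> V) (c : 'I_k -> R) (b : 'I_k -> R),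
    S = [set xa | forall i, dotp (p i) xa.1 + c i * xa.2 <= b i].

Definition epigraph (g : V -> \bar R) : set (V * R) :=
  [set xa | (g xa.1 <= xa.2%:E)%E].

Definition polyhedral_fun (g : V -> \bar R) : Prop :=
  proper_fun g /\ polyhedral_set_prod (epigraph g).

Definition subdiff (g : V -> \bar R) (z : V) : set V :=
  [set l | g z \is a fin_num /\
           forall w, (g z + (dotp l (w - z))%:E <= g w)%E].

Definition aff_hull (C : set V) : set V :=
  [set y | exists (n : nat) (p : 'I_n -> V) (t : 'I_n -> R),
     (forall i, C (p i)) /\ \sum_(i < n) t i = 1 /\
     y = \sum_(i < n) t i *: p i].

Definition rel_int (C : set V) : set V :=
  [set x | C x /\ exists e : R, 0 < e /\ (ball x e `&` aff_hull C `<=` C)].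

Definition conjugate (g : V -> \bar R) : V -> \bar R :=
  fun y => ereal_sup [set ((dotp y x)%:E - g x)%E | x in [set: V]].

(* subderivative  dg(z)(w) = liminf_{t \searrow 0, w' -> w} (g(z+tw')-g(z))/t *)
Definition subderiv (g : V -> \bar R) (z w : V) : \bar R :=
  ereal_sup [set ereal_inf [set v | exists (t : R) (w' : V),
                              0 < t < e /\ `|w' - w| < e /\
                              v = ((g (z + t *: w')%R - g z) * (t^-1)%:E)%E]
            | e in [set e : R | 0 < e]].

Definition crit_cone (g : V -> \bar R) (z l : V) : set V :=
  [set w | (dotp l w)%:E = subderiv g z w].

Definition moreau (r : R) (g : V -> \bar R) (x : V) : \bar R :=
  ereal_inf [set (g w + ((2 * r)^-1 * sqnorm (w - x))%:E)%E | w in [set: V]].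

Definition prox_set (r : R) (g : V -> \bar R) (x : V) : set V :=
  [set w | forall w', (g w + ((2 * r)^-1 * sqnorm (w - x))%:E <=
                       g w' + ((2 * r)^-1 * sqnorm (w' - x))%:E)%E].

(* prox as a function: an element of the argmin (a singleton for proper
   lsc convex g, in particular polyhedral g and r > 0) *)
Definition prox (r : R) (g : V -> \bar R) (x : V) : V :=
  xget 0 (prox_set r g x).

(* Jacobian (row-vector convention: u *m jac f x = 'd f x u) and gradient *)
Definition jac (f : V -> V) (x : V) : 'M[R]_m := lin1_mx ('d f x).
Definition grad (h : V -> R) (x : V) : V := \row_i ('d h x (delta_mx ord0 i)).
Definition hess (h : V -> R) (x : V) : 'M[R]_m := jac (grad h) x.

Definition C1_near (f : V -> V) (x0 : V) : Prop :=
  \forall x \near x0, differentiable f x /\ {for x, continuous (jac f)}.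
Definition C2_near (h : V -> R) (x0 : V) : Prop :=
  \forall x \near x0, differentiable h x /\ differentiable (grad h) x /\
                      {for x, continuous (hess h)}.

Definition is_proj_mx (K : set V) (P : 'M[R]_m) : Prop :=
  forall u, K (u *m P) /\ forall w, K w -> sqnorm (u - u *m P) <= sqnorm (u - w).

End Defs.

(* Main.v *)
Require Import Defs.
From HB Require Import structures.
From mathcomp Require Import all_boot all_order all_algebra.
From mathcomp Require Import all_classical all_reals all_analysis.
From mathcomp Require Import ring lra.
Import Order.TTheory GRing.Theory Num.Theory.
Import numFieldNormedType.Exports.
Local Open Scope classical_set_scope.
Local Open Scope ring_scope.
Set Implicit Arguments.
Unset Strict Implicit.

(** Near [(zb, g zb)] the epigraph of [g] is the cone cut out by the active
    constraints [p_i.w + c_i.a <= 0], so the critical cone is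
    [K = {w | q_i.w <= 0}] with [q_i = p_i + c_i lb].  Each [lb + q_i/(1 - c_i)]
    is again a subgradient, so [lb] is a relative interior point iff [K] is the
    subspace orthogonal to all [q_i].  In that case, for small [u] with
    projection [w] on [K], the vector [lb + (u - w)/r] is a subgradient at
    [zb + w], i.e. [prox (zb + r lb + u) = zb + w]: the prox is affine near
    [zb + r lb], and the gradient [(x - prox x)/r] of the envelope follows.
    Conversely [prox] moves with velocity [w] in every direction [w] of [K];
    if it is differentiable it also does so in direction [-w], and
    [(x - prox x)/r] being a subgradient then forces [-w] into [K].  A compactness
    argument turns [K = -K] into the relative interior condition. *)

(** * Inner product, and its bounds by the sup norm of row vectors *)

Section Dotp.
Context {R : realType} {m : nat}.
Implicit Types u v w : 'rV[R]_m.

Lemma dotpE u v : dotp u v = (u *m v^T) ord0 ord0.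
Proof. by rewrite mxE; apply: eq_bigr => i _; rewrite mxE. Qed.

Lemma dotpC u v : dotp u v = dotp v u.
Proof. by apply: eq_bigr => i _; rewrite mulrC. Qed.

Lemma dotpDl u v w : dotp (u + v) w = dotp u w + dotp v w.
Proof. by rewrite !dotpE mulmxDl mxE. Qed.

Lemma dotpDr u v w : dotp w (u + v) = dotp w u + dotp w v.
Proof. by rewrite !(dotpC w) dotpDl. Qed.

Lemma dotpZl a u v : dotp (a *: u) v = a * dotp u v.
Proof. by rewrite !dotpE -scalemxAl mxE. Qed.

Lemma dotpZr a u v : dotp v (a *: u) = a * dotp v u.
Proof. by rewrite !(dotpC v) dotpZl. Qed.

Lemma dotpNl u v : dotp (- u) v = - dotp u v.
Proof. by rewrite -scaleN1r dotpZl mulN1r. Qed.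

Lemma dotpNr u v : dotp v (- u) = - dotp v u.
Proof. by rewrite !(dotpC v) dotpNl. Qed.

Lemma dotpBr u v w : dotp w (u - v) = dotp w u - dotp w v.
Proof. by rewrite dotpDr dotpNr. Qed.

Lemma dotp0l v : dotp 0 v = 0.
Proof. by rewrite -(scale0r 0) dotpZl mul0r. Qed.

Lemma dotp0r v : dotp v 0 = 0.
Proof. by rewrite dotpC dotp0l. Qed.

Definition dotpX := (dotpDl, dotpDr, dotpNl, dotpNr, dotpZl, dotpZr).

Lemma dotp_suml (I : finType) (F : I -> 'rV[R]_m) v :
  dotp (\sum_i F i) v = \sum_i dotp (F i) v.
Proof.
by rewrite (big_morph (fun u => dotp u v) (fun x y => dotpDl x y v) (dotp0l v)).
Qed.

Lemma sqnorm_ge0 u : 0 <= dotp u u.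
Proof. by apply: sumr_ge0 => i _; rewrite -expr2 sqr_ge0. Qed.

Lemma sqnorm_le0 u : dotp u u <= 0 -> u = 0.
Proof.
move=> u0; have /eqP : dotp u u = 0 by apply/eqP; rewrite eq_le u0 sqnorm_ge0.
rewrite psumr_eq0 => [/allP /= u0'|i _]; last by rewrite -expr2 sqr_ge0.
apply/rowP => i; rewrite mxE; apply/eqP.
by have := u0' i (mem_index_enum i); rewrite -expr2 sqrf_eq0.
Qed.

Lemma ler_coord u i : `|u ord0 i| <= `|u|.
Proof.
by rewrite [leRHS]/Num.Def.normr /= mx_normrE; apply/bigmax_geP; right => /=; exists (ord0, i).
Qed.

(** The norm is the largest absolute coordinate, hence the factor [m] in this substitute for
    Cauchy-Schwarz. *)
Lemma dotp_norm_le u v : `|dotp u v| <= m%:R * `|u| * `|v|.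
Proof.
apply: (le_trans (ler_norm_sum _ _ _)).
have -> : m%:R * `|u| * `|v| = \sum_(i < m) `|u| * `|v|.
  by rewrite sumr_const card_ord -[RHS]mulr_natl mulrA.
by apply: ler_sum => i _; rewrite normrM ler_pM // ler_coord.
Qed.

Lemma sqr_norm_le u : `|u| ^+ 2 <= dotp u u.
Proof.
have [->|u0] := eqVneq u 0; first by rewrite normr0 expr0n dotp0l.
have : mx_norm u != 0 by rewrite -[mx_norm u]/(`|u|) normr_eq0.
move/mx_norm_neq0 => [[i j]] /=; rewrite -[mx_norm u]/(`|u|) => ->.
rewrite (ord1 i) real_normK ?num_real // /dotp (bigD1 j) //= -expr2 lerDl.
by apply: sumr_ge0 => k _; rewrite -expr2 sqr_ge0.
Qed.

Lemma cvg_dotp (T : Type) (F : set_system T) {FF : Filter F}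
    (f h : T -> 'rV[R]_m) a b :
  f x @[x --> F] --> a -> h x @[x --> F] --> b ->
  dotp (f x) (h x) @[x --> F] --> dotp a b.
Proof.
move=> fa hb; apply: cvg_big => [|i _].
  exact: add_continuous.
apply: cvgM.
  exact: (@cvg_comp _ _ _ f (fun M : 'rV[R]_m => M ord0 i) F _ _ fa (@coord_continuous R 1 m ord0 i a)).
exact: (@cvg_comp _ _ _ h (fun M : 'rV[R]_m => M ord0 i) F _ _ hb (@coord_continuous R 1 m ord0 i b)).
Qed.

End Dotp.

(** * Orthogonal projections onto the row space of a matrix and onto its complement *)

Section OrthogonalProjection.
Context {R : realType} {m k : nat} (Q : 'M[R]_(k, m)).

Definition row_perp : set 'rV[R]_m := [set w | forall i, dotp (row i Q) w = 0].

Definition row_span : set 'rV[R]_m := [set v | exists a : 'rV[R]_k, v = a *m Q].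

Lemma dotp_mulmx (a : 'rV[R]_k) w :
  dotp (a *m Q) w = \sum_i a ord0 i * dotp (row i Q) w.
Proof. by rewrite mulmx_sum_row dotp_suml; apply: eq_bigr => i _; rewrite dotpZl. Qed.

Lemma row_span_perp v w : row_span v -> row_perp w -> dotp v w = 0.
Proof.
by move=> [a ->] w0; rewrite dotp_mulmx big1 // => i _; rewrite w0 mulr0.
Qed.

Lemma row_span_perp_sqnorm v w : row_span v -> row_perp w ->
  dotp (v + w) (v + w) = dotp v v + dotp w w.
Proof. by move=> vS wP; rewrite !dotpX (dotpC w v) (row_span_perp vS wP); ring. Qed.

Lemma row_perpP w : row_perp w <-> w *m Q^T = 0.
Proof.
split=> [w0|/rowP w0 i].
  apply/rowP => i; rewrite !mxE -[RHS](w0 i); apply: eq_bigr => j _.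
  by rewrite !mxE mulrC.
have := w0 i; rewrite !mxE => <-.
by apply: eq_bigr => j _; rewrite !mxE mulrC.
Qed.

(** The row space and the kernel of [Q^T] meet only in 0, a common vector being orthogonal to
    itself, and their ranks add up to [m]; [P] projects onto the kernel along the row space. *)
Lemma exists_orth_proj : exists P : 'M[R]_m,
  forall u, row_perp (u *m P) /\ row_span (u - u *m P).
Proof.
pose B := kermx Q^T.
have dx : (<<Q>> :&: B = 0)%MS.
  apply/eqP/rowV0P => v; rewrite sub_capmx genmxE => /andP[/submxP[a va] /sub_kermxP /row_perpP v0].
  by apply: sqnorm_le0; rewrite {1}va (@row_span_perp _ v) //; exists a.
have rk : (1%:M <= <<Q>> + B)%MS.
  rewrite sub1mx /row_full; apply/eqP.
  by rewrite (mxrank_disjoint_sum dx) genmxE mxrank_ker mxrank_tr subnKC // rank_leq_col.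
exists (1%:M - proj_mx <<Q>>%MS B) => u.
have -> : u *m (1%:M - proj_mx <<Q>>%MS B) = u - u *m proj_mx <<Q>>%MS B.
  by rewrite mulmxBr mulmx1.
split.
  apply/row_perpP/sub_kermxP.
  by apply: proj_mx_compl_sub; apply: submx_trans rk; apply: submx1.
rewrite subKr; have := proj_mx_sub <<Q>>%MS B u.
by rewrite genmxE => /submxP.
Qed.

Variable P : 'M[R]_m.
Hypothesis PP : forall u, row_perp (u *m P) /\ row_span (u - u *m P).

Lemma orth_proj_id w : row_perp w -> w *m P = w.
Proof.
move=> w0; have [Pw Sw] := PP w; apply/esym/eqP; rewrite -subr_eq0; apply/eqP.
apply: sqnorm_le0; rewrite dotpDr dotpNr.
by rewrite (row_span_perp Sw w0) (row_span_perp Sw Pw) subrr.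
Qed.

(** [v *m P] is orthogonal to both [v] and [v - v *m P], hence to itself. *)
Lemma orth_proj_span v : (forall w, row_perp w -> dotp v w = 0) -> row_span v.
Proof.
move=> v0; have [Pv Sv] := PP v.
suff v1 : v *m P = 0 by move: Sv; rewrite v1 subr0.
apply: sqnorm_le0.
have := row_span_perp Sv Pv; rewrite dotpDl dotpNl (v0 _ Pv); lra.
Qed.

Lemma is_proj_mx_perp : is_proj_mx row_perp P.
Proof.
move=> u; have [Pu Su] := PP u; split => // w w0; rewrite /sqnorm.
have d0 : row_perp (u *m P - w).
  by move=> i; rewrite dotpDr dotpNr Pu w0 subrr.
have -> : u - w = (u - u *m P) + (u *m P - w) by rewrite addrA subrK.
by rewrite (row_span_perp_sqnorm Su d0) lerDl sqnorm_ge0.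
Qed.

Lemma is_proj_mx_span : is_proj_mx row_span (1%:M - P).
Proof.
move=> u; have [Pu Su] := PP u; rewrite mulmxBr mulmx1; split => // w w0.
rewrite /sqnorm.
have d0 : row_span (u - u *m P - w).
  have [a ->] := Su; have [b ->] := w0; exists (a - b).
  by rewrite mulmxBl.
have -> : u - w = (u - u *m P - w) + u *m P by rewrite addrAC subrK.
by rewrite subKr (row_span_perp_sqnorm d0 Pu) lerDr sqnorm_ge0.
Qed.

End OrthogonalProjection.

(** * Derivatives of locally affine maps and of functions with quadratic error *)

Section Differentiability.
Context {R : realType}.

Lemma diff_of_error (V W : normedModType R) (f : V -> W) (df : {linear V -> W}) x :
  continuous df ->
  (forall e, 0 < e -> \forall u \near 0, `|f (u + x) - f x - df u| <= e * `|u|) ->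
  differentiable f x /\ 'd f x = df :> (V -> W).
Proof.
move=> dfc fe.
have fo : f \o shift x = cst (f x) + df +o_ 0 id.
  apply/eqaddoP => e /fe; apply: filterS => u /=.
  by rewrite -[X in _ -> `|X| <= _]/(f (u + x) - (f x + df u)) opprD addrA.
have dE := diff_unique dfc fo; split => //.
by apply/diff_locallyP; rewrite dE.
Qed.

Context {m : nat}.

Lemma diff_of_sqr_error (f : 'rV[R]_m -> R) (df : {linear 'rV[R]_m -> R}) x C :
  continuous df ->
  (forall u, `|f (u + x) - f x - df u| <= C * `|u| ^+ 2) ->
  differentiable f x /\ 'd f x = df :> ('rV[R]_m -> R).
Proof.
move=> dfc fC; apply: diff_of_error => // e e0; near=> u.
have C1 : 0 < `|C| + 1 by rewrite ltr_wpDl.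
apply: (le_trans (fC u)); rewrite expr2 mulrA ler_wpM2r //.
apply: (@le_trans _ _ ((`|C| + 1) * `|u|)).
  by rewrite ler_wpM2r // (le_trans (ler_norm C)) // lerDl.
rewrite mulrC -ler_pdivlMr //.
near: u; apply/(@nbhs_norm0P R 'rV[R]_m); exists (e / (`|C| + 1)) => /=.
  by rewrite divr_gt0.
by move=> u /= /ltW.
Unshelve. all: by end_near. Qed.

Lemma mulmxr_continuous (P : 'M[R]_m) : continuous (mulmxr P : 'rV[R]_m -> 'rV[R]_m).
Proof.
apply: bounded_linear_continuous; apply/linear_boundedP.
exists (m%:R * `|P|); split => [|M /ltW ltM u]; first exact: num_real.
rewrite [leLHS]/Num.Def.normr /= mx_normrE.
have u0 : 0 <= M * `|u|.
  by rewrite mulr_ge0 // (le_trans _ ltM) // mulr_ge0.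
apply: bigmax_le => // -[i j] _ /=; rewrite mxE.
apply: (le_trans (ler_norm_sum _ _ _)).
apply: (@le_trans _ _ (m%:R * `|P| * `|u|)); last by rewrite ler_wpM2r.
have -> : m%:R * `|P| * `|u| = \sum_(k < m) `|u| * `|P|.
  by rewrite sumr_const card_ord -[RHS]mulr_natl; ring.
apply: ler_sum => k _; rewrite (ord1 i) normrM ler_pM // ?ler_coord //.
by rewrite [leRHS]/Num.Def.normr /= mx_normrE; apply/bigmax_geP; right => /=; exists (k, j).
Qed.

Lemma near_affine_jac (f : 'rV[R]_m -> 'rV[R]_m) (x0 a b : 'rV[R]_m) (P : 'M[R]_m) :
  (\forall x \near x0, f x = a + (x - b) *m P) ->
  \forall x \near x0, differentiable f x /\ jac f x = P.
Proof.
(* For [x] near [x0] the formula holds on a whole neighborhood of [x], where the first-order error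
   is thus 0. *)
move=> /near_join; apply: filterS => x fE.
have dfc := @mulmxr_continuous P.
have [|df dfE] := @diff_of_error _ _ f (mulmxr P) x dfc.
  move=> e e0; have fx := nbhs_singleton fE.
  move: fE; rewrite (near_shift 0) subr0; apply: filterS => u /= ->.
  rewrite fx [X in `|X|](_ : _ = 0) ?normr0 ?mulr_ge0 // 1?ltW //.
  rewrite !mulmxBl mulmxDl; apply/rowP => i; rewrite !mxE; ring.
split=> //; apply/row_matrixP => i; rewrite !rowE /jac mul_rV_lin1.
by rewrite dfE.
Qed.

Lemma continuous_jac_near (f : 'rV[R]_m -> 'rV[R]_m) (x : 'rV[R]_m) (P : 'M[R]_m) :
  (\forall y \near x, jac f y = P) -> {for x, continuous (jac f)}.
Proof.
move=> fP; have fx := nbhs_singleton fP.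
rewrite /prop_for /continuous_at fx.
exact: (@cvg_near_cst _ _ P (jac f) (nbhs x) _ fP).
Qed.

Lemma dotp_differential (s : 'rV[R]_m) : exists df : {linear 'rV[R]_m -> R},
  continuous df /\ forall u, df u = dotp s u.
Proof.
have lin : linear (dotp s : 'rV[R]_m -> R^o).
  by move=> c u v; rewrite dotpDr dotpZr.
pose h := GRing.isLinear.Build R 'rV[R]_m R^o *:%R (dotp s) lin.
pose df : {linear 'rV[R]_m -> R^o} := HB.pack (dotp s : 'rV[R]_m -> R^o) h.
exists df; split => // x.
apply: (@cvg_dotp R m _ (nbhs x) _ (cst s) id s x); [exact: cvg_cst|exact: cvg_id].
Qed.

Lemma grad_of_sqr_error (f : 'rV[R]_m -> R) (s x : 'rV[R]_m) C :
  (forall u, `|f (u + x) - f x - dotp s u| <= C * `|u| ^+ 2) ->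
  differentiable f x /\ grad f x = s.
Proof.
move=> fC; have [df [dfc dfE]] := dotp_differential s.
have [|df' E] := @diff_of_sqr_error f df x C dfc.
  by move=> u; rewrite dfE.
split => //; apply/rowP => i; rewrite mxE E dfE.
rewrite /dotp (bigD1 i) //= mxE !eqxx mulr1 big1 ?addr0 // => j ji.
by rewrite mxE eqxx (negbTE ji) mulr0.
Qed.

End Differentiability.

(** * Subgradients and the proximal points they produce *)

Section Subdifferential.
Context {R : realType} {m : nat} (g : 'rV[R]_m -> \bar R).

(** Testing on epigraph points [(w, y)] keeps the inequality real-valued: [+oo] imposes nothing, and
    [-oo] is refuted by a low enough [y]. *)
Lemma subdiffP z l : subdiff g z l <->
  exists2 a, g z = a%:E &
    forall w y, (g w <= y%:E)%E -> a + dotp l (w - z) <= y.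
Proof.
split=> [[/fineK <- gz]|[a gz gw]].
  by exists (fine (g z)) => // w y /(le_trans (gz w)); rewrite -EFinD lee_fin.
split; first by rewrite gz.
move=> w; rewrite gz -EFinD; case E : (g w) => [y| |]; last 2 first.
- by rewrite leey.
- by have := gw w (a + dotp l (w - z) - 1); rewrite E leNye lerDl oppr_ge0 ler10 => /(_ isT).
by rewrite lee_fin gw // E.
Qed.

Lemma subdiff_monotone z z' l l' : subdiff g z l -> subdiff g z' l' ->
  0 <= dotp (l - l') (z - z').
Proof.
move=> /subdiffP[a ga ha] /subdiffP[a' ga' ha'].
have := ha z' a'; have := ha' z a; rewrite ga ga' !lexx => /(_ isT) + /(_ isT).
rewrite !dotpX; lra.
Qed.

Variable r : R.
Hypothesis r0 : 0 < r.

(** The linear part of the quadratic term at [q] is [- dotp s (w - q)], which the subgradient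
    inequality compensates; a nonnegative square remains. *)
Lemma subdiff_prox q s : subdiff g q s -> prox_set r g (q + r *: s) q.
Proof.
move=> /subdiffP[a gq gw] w; rewrite gq; case E : (g w) => [y| |]; last 2 first.
- by rewrite leey.
- by have := gw w (a + dotp s (w - q) - 1); rewrite E leNye lerDl oppr_ge0 ler10 => /(_ isT).
rewrite -!EFinD lee_fin /sqnorm; have := gw w y; rewrite E lexx => /(_ isT).
move=> ay; suff : 0 <= dotp s (w - q) + (2 * r)^-1 *
    (dotp (w - (q + r *: s)) (w - (q + r *: s)) -
     dotp (q - (q + r *: s)) (q - (q + r *: s))) by lra.
have -> : dotp s (w - q) + (2 * r)^-1 *
    (dotp (w - (q + r *: s)) (w - (q + r *: s)) -
     dotp (q - (q + r *: s)) (q - (q + r *: s))) =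
    (2 * r)^-1 * dotp (w - q) (w - q).
  rewrite !dotpX (dotpC q w) (dotpC s w) (dotpC s q); field.
  by rewrite gt_eqF.
by rewrite mulr_ge0 ?sqnorm_ge0 // invr_ge0 mulr_ge0 // ltW.
Qed.

Lemma moreau_prox x q : prox_set r g x q ->
  moreau r g x = (g q + ((2 * r)^-1 * sqnorm (q - x))%:E)%E.
Proof.
move=> xq; apply/eqP; rewrite eq_le; apply/andP; split.
  by apply: ereal_inf_lbound; exists q.
by apply: le_ereal_inf_tmp => _ [w _ <-]; exact: xq.
Qed.

End Subdifferential.

(** * Proximal mapping and Moreau envelope for a polyhedral epigraph *)

Section Polyhedral.
Context {R : realType} {m : nat} (g : 'rV[R]_m -> \bar R).
Context {k : nat} (p : 'I_k -> 'rV[R]_m) (c b : 'I_k -> R).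
Hypothesis g_proper : proper_fun g.
Hypothesis epiE : forall x a,
  (g x <= a%:E)%E <-> forall i, dotp (p i) x + c i * a <= b i.

Lemma epi_convex x a x' a' t : 0 <= t <= 1 -> (g x <= a%:E)%E -> (g x' <= a'%:E)%E ->
  (g (x + t *: (x' - x)) <= (a + t * (a' - a))%:E)%E.
Proof.
move=> /andP[t0 t1] /epiE gx /epiE gx'; apply/epiE => i.
have := ler_wpM2l t0 (gx' i).
have : (1 - t) * (dotp (p i) x + c i * a) <= (1 - t) * b i.
  by rewrite ler_wpM2l // subr_ge0.
rewrite !dotpX; lra.
Qed.

Variable r : R.
Hypothesis r0 : 0 < r.

(** If an epigraph point [(w, y)] violated the inequality by [d > 0], moving a fraction [t] from
    [(q, a)] towards it would lower the objective by at least [t * (d - t * N)]. *)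
Lemma prox_subdiff q s : prox_set r g (q + r *: s) q -> subdiff g q s.
Proof.
move=> gmin; have [gN [x0 gx0]] := g_proper.
have [a gq] : exists a, g q = a%:E.
  exists (fine (g q)); rewrite fineK // fin_numE gN /=; apply/negP => /eqP gq.
  by have := gmin x0; rewrite gq -(fineK gx0).
apply/subdiffP; exists a => // w y gw; rewrite leNgt; apply/negP => lt_y.
pose d := a + dotp s (w - q) - y; pose N := (2 * r)^-1 * dotp (w - q) (w - q).
have d0 : 0 < d by rewrite subr_gt0.
have N0 : 0 <= N by rewrite mulr_ge0 ?sqnorm_ge0 // invr_ge0 mulr_ge0 // ltW.
have dN : 0 < d + 2 * N by rewrite ltr_wpDr // mulr_ge0.
(* This choice gives both [t <= 1] and [t * N < d], also when [N = 0]. *)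
pose t := d / (d + 2 * N).
have t0 : 0 < t by rewrite divr_gt0.
have t1 : t <= 1 by rewrite ler_pdivrMr // mul1r lerDl mulr_ge0.
have tN : t * N < d.
  rewrite /t mulrAC ltr_pdivrMr // ltr_pM2l //; lra.
have tt : 0 <= t <= 1 by rewrite (ltW t0).
have gqa : (g q <= a%:E)%E by rewrite gq.
have gc := epi_convex tt gqa gw.
have := le_trans (gmin _) (leeD2r _ gc).
rewrite gq -!EFinD lee_fin /sqnorm; apply/negP; rewrite -ltNge.
rewrite -subr_gt0; have -> : a + (2 * r)^-1 * dotp (q - (q + r *: s)) (q - (q + r *: s)) -
  (a + t * (y - a) + (2 * r)^-1 * dotp (q + t *: (w - q) - (q + r *: s))
     (q + t *: (w - q) - (q + r *: s))) = t * (d - t * N).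
  rewrite /d /N !dotpX (dotpC q w) (dotpC s w) (dotpC s q); field.
  by rewrite gt_eqF.
by rewrite mulr_gt0 // subr_gt0.
Qed.

Lemma prox_setP x q : prox_set r g x q <-> subdiff g q (r^-1 *: (x - q)).
Proof.
have xE : x = q + r *: (r^-1 *: (x - q)).
  by rewrite scalerA divff ?gt_eqF // scale1r addrC subrK.
by split=> [|/(subdiff_prox r0)]; rewrite -?xE // {1}xE; exact: prox_subdiff.
Qed.

Lemma prox_set_uniq x q q' : prox_set r g x q -> prox_set r g x q' -> q = q'.
Proof.
move=> /prox_setP sq /prox_setP sq'; have := subdiff_monotone sq sq'.
have -> : dotp (r^-1 *: (x - q) - r^-1 *: (x - q')) (q - q') =
  - (r^-1 * dotp (q - q') (q - q')) by rewrite !dotpX; ring.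
rewrite oppr_ge0 pmulr_rle0 ?invr_gt0 // => /sqnorm_le0 /eqP.
by rewrite subr_eq0 => /eqP.
Qed.

Lemma proxE x q : prox_set r g x q -> prox r g x = q.
Proof.
move=> xq; apply: prox_set_uniq (xq).
by apply: xgetPex; exists q.
Qed.

Context {zb lb : 'rV[R]_m}.
Hypothesis sub_zb : subdiff g zb lb.

(** The proximal objective lifted to the epigraph: a real height replaces the extended value of [g],
    which makes it continuous. *)
Let F (x : 'rV[R]_m) (u : 'rV[R]_m * R) : R :=
  u.2 + (2 * r)^-1 * dotp (u.1 - x) (u.1 - x).

Let F_continuous x : continuous (F x).
Proof.
move=> u; apply: cvgD; first exact: cvg_snd.
apply: cvgMr; apply: cvg_dotp; apply: cvgB; (try exact: cvg_cst); exact: cvg_fst.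
Qed.

Lemma epi_closed : closed [set u : 'rV[R]_m * R | (g u.1 <= u.2%:E)%E].
Proof.
have -> : [set u : 'rV[R]_m * R | (g u.1 <= u.2%:E)%E] =
  \bigcap_(i in [set: 'I_k]) [set u | dotp (p i) u.1 + c i * u.2 <= b i].
  apply/seteqP; split=> u /=.
    by move=> /epiE ub i _; exact: ub.
  by move=> ub; apply/epiE => i; exact: (ub i I).
apply: closed_bigI => i _.
apply: (@preimage_closed _ _ (fun u : 'rV[R]_m * R => dotp (p i) u.1 + c i * u.2)
  [set y | y <= b i] _ (@closed_le R (b i))) => u _.
apply: cvgD.
  apply: cvg_dotp; [exact: cvg_cst|exact: cvg_fst].
by apply: cvgMr; exact: cvg_snd.
Qed.

(** The affine minorant of slope [lb] bounds the sublevel set of [F x] in the closed epigraph, so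
    compactness yields a minimum. *)
Lemma prox_exists x : exists q, prox_set r g x q.
Proof.
have /subdiffP[a gz gw] := sub_zb.
pose M := F x (zb, a).
pose S := [set u : 'rV[R]_m * R | (g u.1 <= u.2%:E)%E] `&` [set u | F x u <= M].
(* Completing the square in [dotp lb w + (2 * r)^-1 * dotp (w - x) (w - x)] gives the center [y0];
   [C] bounds the squared distance to it on [S]. *)
pose y0 := x - r *: lb.
pose C := 2 * r * (M - a - dotp lb (x - zb)) + r ^+ 2 * dotp lb lb.
have C1 : 0 <= `|C| + 1 by rewrite addr_ge0.
have Sw u : S u -> `|u.1 - y0| <= `|C| + 1.
  move=> [gu /= FM]; have ua := gw _ _ gu.
  have : dotp (u.1 - y0) (u.1 - y0) <= C.
    have : (2 * r) * (F x u + (a + dotp lb (u.1 - zb) - u.2)) <= 2 * r * M.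
      rewrite ler_wpM2l //; first by rewrite mulr_ge0 // ltW.
      lra.
    have -> : (2 * r) * (F x u + (a + dotp lb (u.1 - zb) - u.2)) =
        dotp (u.1 - x) (u.1 - x) + 2 * r * (a + dotp lb (u.1 - zb)).
      by rewrite /F; field; rewrite gt_eqF.
    rewrite /C /y0 !dotpX (dotpC lb x) (dotpC lb u.1) (dotpC x u.1); lra.
  move=> /(le_trans (sqr_norm_le _)) /le_trans /(_ (ler_norm C)) le_C.
  rewrite -(@ler_pXn2r _ 2) // ?nnegrE //; apply: (le_trans le_C).
  have := normr_ge0 C; nra.
pose L := a - m%:R * `|lb| * (`|C| + 1 + `|y0 - zb|).
have Sa u : S u -> L <= u.2 <= M.
  move=> Su; have Suw := Sw _ Su; case: Su => gu /= FM.
  have ua := gw _ _ gu; apply/andP; split.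
    apply: le_trans ua; rewrite lerD2l lerNl; apply: (le_trans (ler_norm _)).
    rewrite normrN; apply: (le_trans (dotp_norm_le _ _)).
    rewrite ler_wpM2l ?mulr_ge0 //.
    have -> : u.1 - zb = (u.1 - y0) + (y0 - zb) by rewrite addrA subrK.
    by apply: (le_trans (ler_normD _ _)); rewrite lerD2r.
  apply: le_trans FM; rewrite lerDl mulr_ge0 ?sqnorm_ge0 // invr_ge0.
  by rewrite mulr_ge0 // ltW.
have cB : compact ([set w : 'rV[R]_m | `|w - y0| <= `|C| + 1] `*` `[L, M]%classic).
  apply: compact_setX; last exact: segment_compact.
  apply: bounded_closed_compact.
    exists (`|C| + 1 + `|y0|); split => [|N /ltW ltN w /= wC]; first exact: num_real.
    apply: le_trans ltN; rewrite -(subrK y0 w).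
    by apply: (le_trans (ler_normD _ _)); rewrite lerD2r.
  apply: (@preimage_closed _ _ (fun w : 'rV[R]_m => `|w - y0|)
    [set y | y <= `|C| + 1] _ (@closed_le R _)) => w _.
  have wy : v - y0 @[v --> w] --> w - y0.
    apply: (@cvgB _ 'rV[R]_m _ (nbhs w) _ id (cst y0) w y0); [exact: cvg_id|exact: cvg_cst].
  exact: (cvg_norm wy).
have cS : compact S.
  apply: subclosed_compact cB _.
    apply: closedI; first exact: epi_closed.
    by apply: (@preimage_closed _ _ (F x) [set y | y <= M] _ (@closed_le R _)) => w _; exact: F_continuous.
  move=> u Su; split; first exact: Sw.
  by rewrite /= in_itv /=; exact: Sa.
have S0 : S !=set0 by exists (zb, a); split => //=; rewrite gz.
have [u /set_mem [gu FM] umin] := compact_EVT_min S0 cS (continuous_subspaceT (@F_continuous x)).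
exists u.1 => w; apply: (@le_trans _ _ (F x u)%:E).
  by rewrite EFinD leeD2r.
have [gN _] := g_proper.
case E : (g w) => [y| |]; last 2 first.
- by rewrite leey.
- by have := gN w; rewrite E.
rewrite -EFinD lee_fin -[leRHS]/(F x (w, y)).
have [wM|/ltW] := leP (F x (w, y)) M; last by apply: le_trans.
by apply: umin; apply/mem_set; split => //=; rewrite E.
Qed.

Lemma prox_prox_set x : prox_set r g x (prox r g x).
Proof. by have [q xq] := prox_exists x; rewrite (proxE xq). Qed.

Lemma subdiff_prox_at x : subdiff g (prox r g x) (r^-1 *: (x - prox r g x)).
Proof. exact/prox_setP/prox_prox_set. Qed.

(** The first-order error lies between 0 and [(2 * r)^-1 * dotp u u]: the upper bound uses
    [prox r g x] as a competitor at [u + x], the lower one the subgradient at [prox r g x]. *)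
Lemma moreau_grad x : differentiable (fun y => fine (moreau r g y)) x /\
  grad (fun y => fine (moreau r g y)) x = r^-1 *: (x - prox r g x).
Proof.
apply: (@grad_of_sqr_error _ _ _ _ _ ((2 * r)^-1 * m%:R)) => u.
have mo y : exists2 a, g (prox r g y) = a%:E &
    fine (moreau r g y) = a + (2 * r)^-1 * dotp (prox r g y - y) (prox r g y - y).
  have /subdiffP[a ga _] := subdiff_prox_at y; exists a => //.
  by rewrite (moreau_prox (prox_prox_set y)) ga.
have [a ga ->] := mo x; have [a' ga' mE] := mo (u + x).
have /subdiffP[a1 + gw] := subdiff_prox_at x; rewrite ga => -[aE].
have lo := gw (prox r g (u + x)) a'; rewrite ga' lexx -aE in lo; have {}lo := lo isT.
have := prox_prox_set (u + x) (prox r g x).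
rewrite ga ga' -!EFinD lee_fin /sqnorm -mE.
have := mE.
move: (fine _) => e' {}mE up.
set q := prox r g x in ga lo up *; set q' := prox r g (u + x) in ga' lo mE up *.
set s := r^-1 *: (x - q) in lo *.
have xE : x = q + r *: s.
  by rewrite scalerA divff ?gt_eqF // scale1r addrC subrK.
clearbody s q q'.
have up' : e' - (a + (2 * r)^-1 * dotp (q - x) (q - x)) - dotp s u <= (2 * r)^-1 * dotp u u.
  have -> : (2 * r)^-1 * dotp u u =
      a + (2 * r)^-1 * dotp (q - (u + x)) (q - (u + x)) -
      (a + (2 * r)^-1 * dotp (q - x) (q - x)) - dotp s u.
    by rewrite xE !dotpX (dotpC q u) (dotpC s u) (dotpC s q); field; rewrite gt_eqF.
  lra.
(* The subgradient inequality at [q] bounds the left side below by a square. *)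
have lo' : 0 <= e' - (a + (2 * r)^-1 * dotp (q - x) (q - x)) - dotp s u.
  have : 0 <= (2 * r)^-1 * dotp (q' - (u + x) + r *: s) (q' - (u + x) + r *: s).
    by rewrite mulr_ge0 ?sqnorm_ge0 // invr_ge0 mulr_ge0 // ltW.
  have -> : (2 * r)^-1 * dotp (q' - (u + x) + r *: s) (q' - (u + x) + r *: s) =
      a + dotp s (q' - q) + (2 * r)^-1 * dotp (q' - (u + x)) (q' - (u + x)) -
      (a + (2 * r)^-1 * dotp (q - x) (q - x)) - dotp s u.
    rewrite xE !dotpX (dotpC q' u) (dotpC q' s) (dotpC q' q) (dotpC q u) (dotpC s u) (dotpC s q); field.
    by rewrite gt_eqF.
  lra.
rewrite ger0_norm //; apply: (le_trans up'); rewrite -mulrA ler_wpM2l //.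
  by rewrite invr_ge0 mulr_ge0 // ltW.
by apply: (le_trans (ler_norm _)); rewrite expr2 mulrA; exact: dotp_norm_le.
Qed.

End Polyhedral.

(** * Neighborhoods of 0 along rays *)

Section NearZero.
Context {R : realType} {m : nat}.

Lemma near_scale (P : set 'rV[R]_m) w : (\forall u \near (0 : 'rV[R]_m), P u) ->
  \forall t \near (0 : R)^'+, P (t *: w).
Proof.
move=> nP; have cw : (t *: w) @[t --> (0 : R)^'+] --> (0 : 'rV[R]_m).
  apply: cvg_at_right_filter; rewrite -[X in _ --> X](scale0r w).
  by apply: cvgZr_tmp; exact: cvg_id.
exact: (cw _ nP).
Qed.

Lemma near_pos_scale (P : set 'rV[R]_m) w : (\forall u \near (0 : 'rV[R]_m), P u) ->
  exists t : R, 0 < t /\ P (t *: w).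
Proof.
move=> /(@near_scale _ w) nP.
have : \forall t \near (0 : R)^'+, 0 < t /\ P (t *: w).
  by apply: filterI => //; exact: nbhs_right_gt.
by move=> /filter_ex.
Qed.

End NearZero.

(** * Subderivatives and critical directions *)

Section Subderivative.
Context {R : realType} {m : nat} (f : 'rV[R]_m -> \bar R).

Lemma subderiv_ge z s w : subdiff f z s -> ((dotp s w)%:E <= subderiv f z w)%E.
Proof.
move=> /subdiffP[a fz fw]; apply/lee_addgt0Pr => d d0.
(* At distance [d / N] from [w], replacing [w'] by [w] costs at most [d]; the added 1 keeps [N]
   positive when [s = 0]. *)
pose N := m%:R * `|s| + 1.
have N0 : 0 < N by rewrite ltr_wpDl // mulr_ge0.
rewrite -leeBlDr // -EFinB.
apply: le_trans (ereal_sup_ubound _); last first.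
  by exists (d / N) => //=; rewrite divr_gt0.
apply: le_ereal_inf_tmp => _ [t [w' [/andP[t0 _] [w'w ->]]]].
rewrite fz; case E : (f _) => [y| |]; last 2 first.
- by rewrite /= gt0_mulye ?leey // lte_fin invr_gt0.
- have := fw (z + t *: w') (a + dotp s (z + t *: w' - z) - 1).
  by rewrite E leNye lerDl oppr_ge0 ler10 => /(_ isT).
rewrite -EFinB -EFinM lee_fin ler_pdivlMr //.
have := fw (z + t *: w') y; rewrite E lexx => /(_ isT).
have -> : dotp s (z + t *: w' - z) = t * dotp s w' by rewrite !dotpX; ring.
move=> ay; apply: (@le_trans _ _ (t * dotp s w')); last lra.
rewrite mulrC ler_pM2l // lerBlDl -lerBlDr.
apply: (@le_trans _ _ (dotp s (w - w'))); first by rewrite !dotpX; lra.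
apply: (le_trans (ler_norm _)); apply: (le_trans (dotp_norm_le _ _)).
rewrite distrC; apply: (@le_trans _ _ (N * (d / N))).
  by apply: ler_pM => //; [rewrite lerDl|exact: ltW].
by rewrite mulrC divfK // gt_eqF.
Qed.

Lemma subderiv_le z w a d : f z = a%:E ->
  (\forall t \near (0 : R)^'+, f (z + t *: w) = (a + t * d)%:E) ->
  (subderiv f z w <= d%:E)%E.
Proof.
move=> fz fw; apply: ge_ereal_sup => _ [e /= e0 <-].
have : \forall t \near (0 : R)^'+, 0 < t < e /\ f (z + t *: w) = (a + t * d)%:E.
  apply: filterI => //; near=> t; apply/andP; split; near: t.
    exact: nbhs_right_gt.
  exact: nbhs_right_lt.
move=> /filter_ex[t [te ft]]; apply: ereal_inf_lbound; exists t, w.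
split => //; split; first by rewrite subrr normr0.
have /andP[t0 _] := te.
rewrite ft fz -EFinB -EFinM; congr (_%:E); field.
by rewrite gt_eqF.
Unshelve. all: by end_near. Qed.

(** Choosing the radius [d] in the supremum lets one number control both the distance to [w] and the
    excess of the quotient over [dotp s w]. *)
Lemma crit_coneP z s w d : subdiff f z s -> crit_cone f z s w -> 0 < d ->
  exists t w' y, [/\ 0 < t, `|w' - w| < d, f (z + t *: w') = y%:E &
    y <= fine (f z) + t * (dotp s w + d)].
Proof.
move=> fs fw d0; have /subdiffP[a fz fw'] := fs.
have : (subderiv f z w < (dotp s w + d)%:E)%E.
  by rewrite -fw lte_fin ltrDl.
move=> /(le_lt_trans (ereal_sup_ubound (ex_intro2 _ _ d d0 erefl))).
move=> /ereal_inf_lt[_ [t [w' [/andP[t0 _] [w'w ->]]]]]; rewrite fz.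
case E : (f _) => [y| |].
- rewrite -EFinB -EFinM lte_fin ltr_pdivrMr // => yd.
  exists t, w', y; split=> //=; rewrite ?fz /=; lra.
- by rewrite /= gt0_mulye ?lte_fin ?invr_gt0.
- have := fw' (z + t *: w') (a + dotp s (z + t *: w' - z) - 1).
  by rewrite E leNye lerDl oppr_ge0 ler10 => /(_ isT).
Qed.

End Subderivative.

(** * Subgradients of the Fenchel conjugate *)

Section Conjugate.
Context {R : realType} {m : nat} (g : 'rV[R]_m -> \bar R).

(** Fenchel equality: the subgradient inequality says that the supremum is attained at [z]. *)
Lemma conjugate_subdiff z l a : subdiff g z l -> g z = a%:E ->
  conjugate g l = (dotp l z - a)%:E.
Proof.
move=> /subdiffP[a' + gl] gz; rewrite gz => -[aE]; rewrite -aE in gl.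
apply/eqP; rewrite eq_le; apply/andP; split; last first.
  by apply: ereal_sup_ubound; exists z => //; rewrite gz -EFinB.
apply: ge_ereal_sup => _ [w _ <-]; case E : (g w) => [y| |].
- have := gl w y; rewrite E lexx => /(_ isT).
  by rewrite -EFinB lee_fin dotpDr dotpNr; lra.
- by rewrite /= leNye.
- have := gl w (a + dotp l (w - z) - 1).
  by rewrite E leNye lerDl oppr_ge0 ler10 => /(_ isT).
Qed.

Lemma subdiff_conjugate z l : subdiff g z l -> subdiff (conjugate g) l z.
Proof.
move=> gl; have /subdiffP[a gz _] := gl.
have cl := conjugate_subdiff gl gz; split; first by rewrite cl.
move=> y; rewrite cl -EFinD.
apply: (@le_trans _ _ (dotp y z - a)%:E).
  by rewrite lee_fin dotpDr dotpNr (dotpC z y) (dotpC z l); lra.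
by apply: ereal_sup_ubound; exists z => //; rewrite gz -EFinB.
Qed.

End Conjugate.

(** * Local geometry at a point of the graph of the subdifferential *)

Section LocalAnalysis.
Context {R : realType} {m : nat} (g : 'rV[R]_m -> \bar R).
Context {k : nat} (p : 'I_k -> 'rV[R]_m) (c b : 'I_k -> R).
Hypothesis g_proper : proper_fun g.
Hypothesis epiE : forall x a,
  (g x <= a%:E)%E <-> forall i, dotp (p i) x + c i * a <= b i.
Variables (zb lb : 'rV[R]_m) (a0 : R).
Hypothesis gzb : g zb = a0%:E.
Hypothesis sub_zb : subdiff g zb lb.

Let sub_le w y : (g w <= y%:E)%E -> a0 + dotp lb (w - zb) <= y.
Proof.
have /subdiffP[a] := sub_zb; rewrite gzb => -[->] h; exact: h.
Qed.

Definition active i := dotp (p i) zb + c i * a0 == b i.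

(* Inactive constraints get the zero normal, so that all [i] can be treated alike. *)
Definition crit_normal i := if active i then p i + c i *: lb else 0.

Definition crit_mx := \matrix_i crit_normal i.

Lemma row_crit_mx i : row i crit_mx = crit_normal i.
Proof. exact: rowK. Qed.

Definition crit_poly : set 'rV[R]_m := [set w | forall i, dotp (crit_normal i) w <= 0].

(** The epigraph contains the vertical ray above [(zb, a0)]. *)
Lemma epi_coef_le0 i : c i <= 0.
Proof.
rewrite leNgt; apply/negP => c0.
have g0 y : 0 <= y -> (g zb <= (a0 + y)%:E)%E.
  by move=> y0; rewrite gzb lee_fin lerDl.
have := g0 0 (lexx 0); rewrite addr0 => /epiE /(_ i) s0.
(* At this height constraint [i] would exceed [b i] by 1. *)
have y0 : 0 <= (b i - dotp (p i) zb - c i * a0 + 1) / c i.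
  rewrite divr_ge0 //; [lra|exact: ltW].
have /epiE /(_ i) := g0 _ y0.
by rewrite mulrDr [X in c i * a0 + X]mulrC divfK ?gt_eqF //; lra.
Qed.

(** Heights are measured from the supporting hyperplane of slope [lb]. An active constraint is
    compared with its equality at [(zb, a0)]; for a zero normal, [c i <= 0] and the gap is
    nonnegative. *)
Lemma crit_normal_le w y i : (g w <= y%:E)%E ->
  dotp (crit_normal i) (w - zb) + c i * (y - a0 - dotp lb (w - zb)) <= 0.
Proof.
move=> gw; rewrite /crit_normal; case: ifPn => [/eqP ai|_].
  have /epiE /(_ i) := gw; rewrite -ai !dotpX; lra.
have := sub_le gw; rewrite dotp0l add0r => ?; apply: mulr_le0_ge0.
  exact: epi_coef_le0.
lra.
Qed.

(** Near [zb] inactive constraints stay strict, and over [crit_poly] active ones hold on the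
    supporting hyperplane, so [g] lies below it there; [lb] gives the opposite bound. *)
Lemma near_crit_poly :
  \forall u \near (0 : 'rV[R]_m), crit_poly u -> g (zb + u) = (a0 + dotp lb u)%:E.
Proof.
have : \forall u \near (0 : 'rV[R]_m), forall i, ~~ active i ->
    dotp (p i) (zb + u) + c i * (a0 + dotp lb u) < b i.
  apply: (@filter_forall _ _ (fun i (u : 'rV[R]_m) => ~~ active i ->
    dotp (p i) (zb + u) + c i * (a0 + dotp lb u) < b i) (nbhs (0 : 'rV[R]_m))).
  move=> i; have [ai|nai] := boolP (active i); first exact: nearW.
  have lt_b : dotp (p i) zb + c i * a0 < b i.
    have : (g zb <= a0%:E)%E by rewrite gzb.
    by rewrite lt_neqAle => /epiE gb; apply/andP; split.
  pose h (u : 'rV[R]_m) := dotp (p i) zb + c i * a0 + dotp (p i + c i *: lb) u.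
  have hc : h u @[u --> nbhs (0 : 'rV[R]_m)] --> dotp (p i) zb + c i * a0.
    rewrite -[X in _ --> X]addr0 -(dotp0r (p i + c i *: lb)).
    apply: cvgD; first exact: cvg_cst.
    apply: (@cvg_dotp R m _ (nbhs (0 : 'rV[R]_m)) _ (cst _) id); first exact: cvg_cst.
    exact: cvg_id.
  apply: filterS (cvgr_lt _ hc _ lt_b) => u; rewrite /h !dotpX; lra.
apply: filterS => u hu Ku.
have gle : (g (zb + u) <= (a0 + dotp lb u)%:E)%E.
  apply/epiE => i; have [ai|/hu/ltW //] := boolP (active i).
  have := Ku i; rewrite /crit_normal ai -(eqP ai) !dotpX; lra.
apply/eqP; rewrite eq_le gle /=.
have [gN _] := g_proper; case E : (g _) => [y| |]; last 2 first.
- by rewrite leey.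
- by have := gN (zb + u); rewrite E.
have := @sub_le (zb + u) y; rewrite E lexx => /(_ isT).
by rewrite lee_fin !dotpX; lra.
Qed.

Lemma near_crit_poly_scale w : crit_poly w ->
  \forall t \near (0 : R)^'+, g (zb + t *: w) = (a0 + t * dotp lb w)%:E.
Proof.
move=> Kw; near=> t.
have t0 : 0 < t by near: t; exact: nbhs_right_gt.
rewrite -dotpZr; have : crit_poly (t *: w).
  by move=> i; rewrite dotpZr pmulr_rle0.
near: t; exact: near_scale near_crit_poly.
Unshelve. all: by end_near. Qed.

(** On [crit_poly], [g] is locally affine with slope [lb]. Conversely, dividing a constraint by [t]
    at a nearly optimal quotient leaves errors of order [d] only. *)
Lemma crit_cone_poly : crit_cone g zb lb = crit_poly.
Proof.
apply/seteqP; split=> w Kw; last first.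
  apply/eqP; rewrite eq_le subderiv_ge //=.
  exact: subderiv_le gzb (near_crit_poly_scale Kw).
move=> i; rewrite leNgt; apply/negP => q0.
set q := crit_normal i in q0.
pose C := m%:R * `|q| - c i * (m%:R * `|lb| + 1).
have C0 : 0 <= C.
  have := epi_coef_le0 i => ci.
  by rewrite addr_ge0 ?mulr_ge0 // -mulNr mulr_ge0 ?oppr_ge0 // addr_ge0 // mulr_ge0.
have C1 : 0 < C + 1 by rewrite ltr_wpDl.
(* The errors will add up to [dotp q w <= C * d], which contradicts [dotp q w = (C + 1) * d] with
   [d > 0]. *)
pose d := dotp q w / (C + 1).
have d0 : 0 < d by rewrite divr_gt0.
have [t [w' [y [t0 w'w gy ya]]]] := crit_coneP sub_zb Kw d0.
have := @crit_normal_le (zb + t *: w') y i; rewrite gy lexx => /(_ isT).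
rewrite [zb + _]addrC addrK gzb /= in ya *; rewrite !dotpZr -/q => h1.
have h2 : c i * (t * (dotp lb w + d - dotp lb w')) <= c i * (y - a0 - t * dotp lb w').
  by rewrite ler_wnM2l ?epi_coef_le0 //; lra.
have : t * (dotp q w' + c i * (dotp lb w + d - dotp lb w')) <= 0 by lra.
rewrite pmulr_rle0 // => h3.
have bnd s : dotp s (w - w') <= m%:R * `|s| * d.
  apply: (le_trans (ler_norm _)); apply: (le_trans (dotp_norm_le _ _)).
  by rewrite ler_wpM2l ?mulr_ge0 // distrC ltW.
have h4 := bnd q; have h5 := bnd lb.
have h6 : c i * (m%:R * `|lb| * d) <= c i * dotp lb (w - w').
  by rewrite ler_wnM2l ?epi_coef_le0.
have : dotp q w <= C * d by move: h3 h4 h5 h6; rewrite /C !dotpX; lra.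
rewrite -[X in X <= _](@divfK _ (C + 1)) ?gt_eqF // -/d; nra.
Qed.

(** The normal pairs with [w - zb] to at most [- c i] times the gap above the supporting hyperplane,
    hence at most [1 - c i] times it; this divisor is positive even if [c i = 0]. *)
Lemma subdiff_crit_normal i : subdiff g zb (lb + (1 - c i)^-1 *: crit_normal i).
Proof.
apply/subdiffP; exists a0 => // w y gw.
have h1 := crit_normal_le i gw; have h2 := sub_le gw; have c0 := epi_coef_le0 i.
have c1 : 0 < 1 - c i by lra.
rewrite dotpDl dotpZl addrA -lerBrDl ler_pdivrMl //.
nra.
Qed.

(** Along [w] the function grows exactly with slope [dotp lb w], so no subgradient at [zb] can be
    steeper. *)
Lemma subdiff_crit_poly l w : subdiff g zb l -> crit_poly w -> dotp (l - lb) w <= 0.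
Proof.
move=> /subdiffP[a]; rewrite gzb => -[<-] gl Kw.
have : \forall t \near (0 : R)^'+, 0 < t /\ g (zb + t *: w) = (a0 + t * dotp lb w)%:E.
  apply: filterI; [exact: nbhs_right_gt|exact: near_crit_poly_scale].
move=> /filter_ex[t [t0 gt]].
have := gl (zb + t *: w) (a0 + t * dotp lb w); rewrite gt lexx => /(_ isT).
rewrite [zb + _]addrC addrK dotpZr lerD2l ler_pM2l // dotpDl dotpNl; lra.
Qed.

Lemma row_perp_crit_poly w : row_perp crit_mx w -> crit_poly w.
Proof. by move=> w0 i; have := w0 i; rewrite row_crit_mx => ->. Qed.

Lemma subdiff_row_perp l w : subdiff g zb l -> row_perp crit_mx w ->
  dotp (l - lb) w = 0.
Proof.
move=> gl w0; have h1 := subdiff_crit_poly gl (row_perp_crit_poly w0).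
have w1 : row_perp crit_mx (- w) by move=> i; rewrite dotpNr w0 oppr0.
have := subdiff_crit_poly gl (row_perp_crit_poly w1); rewrite dotpNr; lra.
Qed.

Lemma aff_hull_subdiff v : row_span crit_mx v -> aff_hull (subdiff g zb) (lb + v).
Proof.
move=> [s ->].
(* These weights cancel the factors [(1 - c i)^-1]; the extra index [ord0] carries [lb] and
   completes the sum of the weights to 1. *)
pose w i := s ord0 i * (1 - c i).
pose q j := if unlift ord0 j is Some i
  then lb + (1 - c i)^-1 *: crit_normal i else lb.
pose t j := if unlift ord0 j is Some i then w i else 1 - \sum_i w i.
have t0 : t ord0 = 1 - \sum_i w i by rewrite /t unlift_none.
have tS i : t (lift ord0 i) = w i by rewrite /t liftK.
exists k.+1, q, t; split=> [j|].
  by rewrite /q; case: unlift => [i|//]; exact: subdiff_crit_normal.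
have tE : \sum_(i < k) t (lift ord0 i) = \sum_i w i.
  by apply: eq_bigr => i _; rewrite tS.
rewrite !big_ord_recl tE t0 subrK; split => //.
have -> : \sum_(i < k) t (lift ord0 i) *: q (lift ord0 i) =
    \sum_i w i *: lb + s *m crit_mx.
  rewrite mulmx_sum_row -big_split; apply: eq_bigr => i _.
  rewrite tS /q liftK scalerDr scalerA /w mulfK ?row_crit_mx //.
  by have := epi_coef_le0 i => ?; rewrite gt_eqF //; lra.
by rewrite /q unlift_none -scaler_suml addrA -scalerDl subrK scale1r.
Qed.

Lemma rel_int_ball : rel_int (subdiff g zb) lb -> exists2 e, 0 < e &
  forall v, row_span crit_mx v -> `|v| < e -> subdiff g zb (lb + v).
Proof.
move=> [_ [e [e0 eB]]]; exists e => // v vS ve; apply: eB; split.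
  by rewrite -ball_normE /= opprD addNKr normrN.
exact: aff_hull_subdiff.
Qed.

Lemma row_span_crit_normal i : row_span crit_mx (crit_normal i).
Proof. by exists (delta_mx 0 i); rewrite -rowE row_crit_mx. Qed.

Lemma row_spanZ a v : row_span crit_mx v -> row_span crit_mx (a *: v).
Proof. by move=> [s ->]; exists (a *: s); rewrite scalemxAl. Qed.

Lemma near_norm_lt (e : R) : 0 < e -> \forall u \near (0 : 'rV[R]_m), `|u| < e.
Proof. by move=> e0; apply/(@nbhs_norm0P R 'rV[R]_m); exists e. Qed.

(** A small step from [lb] along [- crit_normal i] still gives a subgradient, which forces
    [dotp (crit_normal i) w >= 0]. *)
Lemma rel_int_row_perp w : rel_int (subdiff g zb) lb -> crit_poly w ->
  row_perp crit_mx w.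
Proof.
move=> /rel_int_ball[e e0 eS] Kw i.
have [t [t0 te]] := near_pos_scale (- crit_normal i) (near_norm_lt e0).
have vS : row_span crit_mx (t *: - crit_normal i).
  by rewrite scalerN -scaleNr; apply/row_spanZ/row_span_crit_normal.
have := subdiff_crit_poly (eS _ vS te) Kw.
rewrite addrC addKr dotpZl dotpNl pmulr_rle0 // oppr_le0 row_crit_mx => ?.
by apply/eqP; rewrite eq_le Kw.
Qed.

(** The minorant of slope [lb] touches [g] at [zb + w]; since [v] is orthogonal to [w], the one of
    slope [lb + v] touches it there too. *)
Lemma subdiff_translate w : g (zb + w) = (a0 + dotp lb w)%:E ->
  forall v, subdiff g zb (lb + v) -> dotp v w = 0 -> subdiff g (zb + w) (lb + v).
Proof.
move=> gw v /subdiffP[a]; rewrite gzb => -[<-] gv vw; apply/subdiffP.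
exists (a0 + dotp lb w) => // x y /gv; rewrite !dotpX vw; lra.
Qed.

Context {P : 'M[R]_m}.
Hypothesis PP : forall u, row_perp crit_mx (u *m P) /\ row_span crit_mx (u - u *m P).

Lemma row_span_projP v : row_span crit_mx v <-> v *m P = 0.
Proof.
have [vP vS] := PP v; split=> [vs|v0]; last by move: vS; rewrite v0 subr0.
apply: sqnorm_le0; have := row_span_perp vS vP.
by rewrite dotpDl dotpNl (row_span_perp vs vP); lra.
Qed.

(** Total violation of the inequalities defining [crit_poly]; it vanishes exactly on that cone. *)
Let phi (u : 'rV[R]_m) := \sum_i Num.max 0 (dotp (crit_normal i) u).

Let phi_ge0 u : 0 <= phi u.
Proof. by apply: sumr_ge0 => i _; rewrite le_max lexx. Qed.

Let phiZ t u : 0 <= t -> phi (t *: u) = t * phi u.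
Proof.
move=> t0; rewrite /phi mulr_sumr; apply: eq_bigr => i _.
by rewrite dotpZr maxr_pMr // mulr0.
Qed.

Let phi_continuous : continuous phi.
Proof.
apply: continuous_big => [|i _]; first exact: add_continuous.
have [df [dfc dfE]] := dotp_differential (crit_normal i).
have -> : (fun u : 'rV[R]_m => Num.max 0 (dotp (crit_normal i) u)) =
    (fun u => Num.max 0 (df u)) by apply/funext => x; rewrite dfE.
by move=> u; apply: continuous_max; [exact: cst_continuous|exact: dfc].
Qed.

(* [phi] is positive on the compact unit sphere of the orthogonal complement of [K]. *)
Lemma crit_gauge_coercive : (forall w, crit_poly w -> row_perp crit_mx w) ->
  exists2 mu, 0 < mu & forall u, row_span crit_mx u -> mu * `|u| <= phi u.
Proof.
move=> KL; pose S := [set u : 'rV[R]_m | `|u| = 1] `&` [set u | u *m P = 0].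
have [S0|/set0P/negP/negPn/eqP S0] := pselect (S !=set0); last first.
  exists 1 => // u /row_span_projP u0; have [->|un0] := eqVneq u 0.
    by rewrite normr0 mulr0.
  have : S (`|u|^-1 *: u).
    split; last by rewrite /= -scalemxAl u0 scaler0.
    by rewrite /= normrZ normfV normr_id mulVf // normr_eq0.
  by rewrite S0.
have cS : compact S.
  apply: bounded_closed_compact.
    exists 1; split => [|M /ltW M1 u [/= -> _]//]; exact: num_real.
  apply: closedI.
    apply: (@preimage_closed _ _ (fun w : 'rV[R]_m => `|w|)
      [set y | y = 1] _ (@closed_eq R 1)) => w _; exact: norm_continuous.
  apply: (@preimage_closed _ _ (mulmxr P : 'rV[R]_m -> 'rV[R]_m)
      [set y | y = 0] _ _) => [w _|]; first exact: mulmxr_continuous.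
  exact: (accessible_closed_set1 (hausdorff_accessible (@norm_hausdorff R 'rV[R]_m))).
have [u /set_mem [/= u1 uP] umin] := EVT_min_rV S0 cS (continuous_subspaceT phi_continuous).
(* A zero of [phi] on [S] would lie both in the row span and in its orthogonal complement. *)
have phi0 : 0 < phi u.
  rewrite lt_neqAle phi_ge0 andbT eq_sym; apply/eqP => /eqP.
  rewrite psumr_eq0 => [/allP /= pu|i _]; last by rewrite le_max lexx.
  have Ku : crit_poly u.
    by move=> i; have := pu i (mem_index_enum i) => /eqP <-; rewrite le_max lexx orbT.
  have := orth_proj_id PP (KL _ Ku); rewrite uP => u0.
  by move: u1; rewrite -u0 normr0 => /eqP; rewrite eq_sym oner_eq0.
exists (phi u) => // v /row_span_projP v0; have [->|vn0] := eqVneq v 0.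
  by rewrite normr0 mulr0.
have v1 : 0 < `|v| by rewrite normr_gt0.
have Sv : S (`|v|^-1 *: v).
  split; last by rewrite /= -scalemxAl v0 scaler0.
  by rewrite /= normrZ normfV normr_id mulVf // gt_eqF.
by have := umin _ (mem_set Sv); rewrite phiZ ?invr_ge0 // ler_pdivlMl // mulrC.
Qed.

(** Only the component [d'] of [w - zb] in the row span pairs with [l - lb], and coercivity of [phi]
    bounds the norm of [d'] by a multiple of the gap above the supporting hyperplane. *)
Lemma row_perp_rel_int : (forall w, crit_poly w -> row_perp crit_mx w) ->
  rel_int (subdiff g zb) lb.
Proof.
move=> KL; have [mu mu0 phi_mu] := crit_gauge_coercive KL; split => //.
pose C := \sum_i - c i.
have C0 : 0 <= C by apply: sumr_ge0 => i _; rewrite oppr_ge0 epi_coef_le0.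
have mC0 : 0 < m%:R * C + 1 by rewrite ltr_wpDl // mulr_ge0.
(* Within this radius, [m * C] times the norm of [l - lb] is at most [mu]. *)
exists (mu / (m%:R * C + 1)); split; first by rewrite divr_gt0.
move=> l [+ lA]; rewrite -ball_normE /= distrC => le.
have lS : row_span crit_mx (l - lb).
  apply: (orth_proj_span PP) => w w0; case: lA => n [q [t [gq [t1 ->]]]].
  have -> : lb = \sum_i t i *: lb by rewrite -scaler_suml t1 scale1r.
  rewrite -sumrB dotp_suml big1 // => i _.
  by rewrite -scalerBr dotpZl (subdiff_row_perp (gq i)) // mulr0.
apply/subdiffP; exists a0 => // w y gw.
have b0 := sub_le gw; set d := w - zb in b0 *.
have [dP dS] := PP d; set d' := d - d *m P in dS.
have dE : dotp (l - lb) d = dotp (l - lb) d'.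
  by rewrite [RHS]dotpBr (row_span_perp lS dP) subr0.
have h1 : mu * `|d'| <= C * (y - a0 - dotp lb d).
  apply: le_trans (phi_mu _ dS) _; rewrite /C mulr_suml; apply: ler_sum => i _.
  rewrite ge_max; apply/andP; split.
    by rewrite mulr_ge0 ?oppr_ge0 ?epi_coef_le0 //; lra.
  have := dP i; rewrite row_crit_mx => di.
  have := crit_normal_le i gw; rewrite -/d (dotpBr d) di; lra.
have h2 : dotp (l - lb) d' <= m%:R * `|l - lb| * `|d'|.
  exact: le_trans (ler_norm _) (dotp_norm_le _ _).
have h3 : `|l - lb| * (m%:R * C + 1) <= mu by rewrite -ler_pdivlMr // ltW.
suff : mu * dotp (l - lb) d' <= mu * (y - a0 - dotp lb d).
  rewrite ler_pM2l // -dE dotpDl dotpNl; lra.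
apply: (@le_trans _ _ (m%:R * `|l - lb| * (mu * `|d'|))).
  by rewrite mulrCA ler_pM2l.
apply: (@le_trans _ _ (m%:R * `|l - lb| * (C * (y - a0 - dotp lb d)))).
  by rewrite ler_wpM2l // mulr_ge0.
rewrite mulrA ler_wpM2r //; first by lra.
apply: le_trans h3; have := normr_ge0 (l - lb); lra.
Qed.

(** Along the row span [lb + t *: v] stays a subgradient at [zb], so the conjugate is affine with
    slope [zb]. Conversely, for [w] in the complement each small [zb + t *: w] is a subgradient of
    the conjugate at [lb], which forces [dotp v w <= 0] for [w] and [- w]. *)
Lemma crit_cone_conjugate : rel_int (subdiff g zb) lb ->
  crit_cone (conjugate g) lb zb = row_span crit_mx.
Proof.
move=> ri; have [e e0 eS] := rel_int_ball ri.
have cz := subdiff_conjugate sub_zb.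
apply/seteqP; split=> v.
  move=> vK; apply: (orth_proj_span PP).
  have half w : row_perp crit_mx w -> dotp v w <= 0.
    move=> w0; have Kw := row_perp_crit_poly w0.
    have : \forall t \near (0 : R)^'+, 0 < t /\ g (zb + t *: w) = (a0 + t * dotp lb w)%:E.
      apply: filterI; [exact: nbhs_right_gt|exact: near_crit_poly_scale].
    move=> /filter_ex[t [t0 gt]].
    have st : subdiff g (zb + t *: w) lb.
      rewrite -(addr0 lb); apply: subdiff_translate; rewrite ?dotp0l ?addr0 //.
      by rewrite gt dotpZr.
    have := subderiv_ge v (subdiff_conjugate st).
    rewrite -vK lee_fin dotpDl dotpZl gerDl pmulr_rle0 // dotpC; exact.
  move=> w w0; apply/eqP; rewrite eq_le half //=.
  have w1 : row_perp crit_mx (- w) by move=> i; rewrite dotpNr w0 oppr0.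
  by have := half _ w1; rewrite dotpNr oppr_le0.
move=> vS; apply/eqP; rewrite eq_le subderiv_ge //=.
apply: (subderiv_le (a := dotp lb zb - a0)).
  exact: conjugate_subdiff.
near=> t; rewrite (conjugate_subdiff (z := zb) (a := a0)) //.
  by rewrite dotpDl dotpZl (dotpC v); congr (_%:E); ring.
apply: eS; first exact: row_spanZ.
near: t; exact: near_scale (near_norm_lt e0).
Unshelve. all: by end_near. Qed.

Variable r : R.
Hypothesis r0 : 0 < r.

Lemma near_mulmx0 (A : 'M[R]_m) (B : set 'rV[R]_m) :
  (\forall u \near (0 : 'rV[R]_m), B u) -> \forall u \near (0 : 'rV[R]_m), B (u *m A).
Proof.
move=> nB; have := @mulmxr_continuous R m A 0; rewrite /continuous_at /= mul0mx.
by move=> /(_ _ nB).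
Qed.

Lemma prox_near : rel_int (subdiff g zb) lb ->
  \forall x \near zb + r *: lb, prox r g x = zb + (x - (zb + r *: lb)) *m P.
Proof.
move=> ri; have [e e0 eS] := rel_int_ball ri.
rewrite (near_shift 0) subr0.
have nA := near_mulmx0 P near_crit_poly.
have nB := near_mulmx0 (r^-1 *: (1%:M - P)) (near_norm_lt e0).
apply: filterS2 nA nB => u uA uB /=; rewrite addrK; apply: (proxE g_proper epiE r0).
have [uP uS] := PP u.
have vE : u *m (r^-1 *: (1%:M - P)) = r^-1 *: (u - u *m P).
  by rewrite -scalemxAr mulmxBr mulmx1.
rewrite vE in uB.
have -> : u + (zb + r *: lb) = (zb + u *m P) + r *: (lb + r^-1 *: (u - u *m P)).
  rewrite scalerDr scalerA divff ?gt_eqF // scale1r.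
  by apply/rowP => i; rewrite !mxE; ring.
apply: (subdiff_prox r0); apply: subdiff_translate.
- exact/uA/row_perp_crit_poly.
- by apply: eS => //; exact: row_spanZ.
- by rewrite dotpZl (row_span_perp uS uP) mulr0.
Qed.

Lemma prox_center : prox r g (zb + r *: lb) = zb.
Proof. exact/(proxE g_proper epiE r0)/subdiff_prox. Qed.

Lemma differentiable_prox_row_perp w : differentiable (prox r g) (zb + r *: lb) ->
  crit_poly w -> row_perp crit_mx w.
Proof.
move=> dp Kw.
have df : derivable (prox r g) (zb + r *: lb) w by exact: diff_derivable.
pose y (h : R) := h^-1 *: (prox r g (h *: w + (zb + r *: lb)) - zb).
have yD : y h @[h --> (0 : R)^'] --> 'D_w (prox r g) (zb + r *: lb).
  have -> : y = fun h => h^-1 *: ((prox r g \o shift (zb + r *: lb)) (h *: w) -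
      prox r g (zb + r *: lb)) by apply/funext => h; rewrite prox_center.
  exact: df.
(* To the right of [0] the difference quotient is exactly [w]. *)
have yw : y h @[h --> (0 : R)^'+] --> w.
  apply: cvg_near_cst; near=> h.
  have h0 : 0 < h by near: h; exact: nbhs_right_gt.
  rewrite /y (proxE g_proper epiE r0 (q := zb + h *: w)).
    by rewrite [zb + _]addrC addrK scalerA mulVf ?scale1r // gt_eqF.
  have -> : h *: w + (zb + r *: lb) = zb + h *: w + r *: (lb + 0).
    by rewrite addr0 addrA [h *: w + _]addrC.
  apply: (subdiff_prox r0); apply: subdiff_translate; rewrite ?dotp0l ?addr0 //.
  rewrite dotpZr; near: h; exact: near_crit_poly_scale.
(* Differentiability makes the left limit of the quotient equal to the right one. *)
have Dw : 'D_w (prox r g) (zb + r *: lb) = w.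
  exact: cvg_unique (cvg_dnbhs_at_right yD) yw.
rewrite Dw in yD; have {yw} yw := cvg_dnbhs_at_left yD.
move=> i; rewrite row_crit_mx; apply/eqP; rewrite eq_le Kw /=.
rewrite /crit_normal; case: ifPn => [/eqP ai|_]; last by rewrite dotp0l.
(* [h * E h] bounds from below the increment of the active constraint [i] from [zb] to the proximal
   point; the limit of [E] is [dotp (crit_normal i) w]. *)
pose E h := dotp (p i) (y h) + c i * dotp (y h) (lb + (h * r^-1) *: (w - y h)).
have Ew : E h @[h --> (0 : R)^'-] --> dotp (p i) w + c i * dotp w (lb + (0 * r^-1) *: (w - w)).
  apply: cvgD; first by apply: cvg_dotp yw; exact: cvg_cst.
  apply: cvgMr; apply: cvg_dotp => //; apply: cvgD; first exact: cvg_cst.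
  apply: cvgZ; last by apply: cvgB => //; exact: cvg_cst.
  by apply: cvgMl; apply: cvg_at_left_filter; exact: cvg_id.
rewrite subrr scaler0 addr0 in Ew.
rewrite dotpDl dotpZl (dotpC lb); apply: (cvgr_to_ge Ew).
near=> h; have h0 : h < 0 by near: h; exact: nbhs_left_lt.
have h1 : h != 0 by rewrite lt_eqF.
have := subdiff_prox_at g_proper epiE r0 sub_zb (h *: w + (zb + r *: lb)).
have qE : prox r g (h *: w + (zb + r *: lb)) = zb + h *: y h.
  by rewrite /y scalerA divff // scale1r [RHS]addrC subrK.
rewrite qE => /subdiffP[a ga gs].
(* Testing the subgradient at the proximal point against [zb] bounds the height [a] from above. With
   [c i <= 0] this gives [h * E h <= 0], and [h < 0] reverses the sign. *)
have := gs zb a0; rewrite gzb lexx => /(_ isT).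
have -> : r^-1 *: (h *: w + (zb + r *: lb) - (zb + h *: y h)) =
    lb + (h * r^-1) *: (w - y h).
  by move: (y h) => v; apply/rowP => j; rewrite !mxE; field; rewrite gt_eqF.
have := epiE (zb + h *: y h) a; rewrite ga lexx => -[/(_ isT) /(_ i) + _].
rewrite -ai /E; set s := lb + _ => h2 h3; rewrite -(nmulr_rle0 _ h0).
have h4 : c i * (a0 + h * dotp s (y h)) <= c i * a.
  rewrite ler_wnM2l ?epi_coef_le0 //.
  by move: h3; rewrite opprD addrA subrr add0r dotpNr dotpZr; lra.
move: h2 h4; rewrite dotpDr dotpZr (dotpC s); lra.
Unshelve. all: by end_near. Qed.

End LocalAnalysis.

(** * From local affine formulas to smoothness, and the equivalences *)

Lemma near_affine_C1 {R : realType} {m : nat} (f : 'rV[R]_m -> 'rV[R]_m)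
    (x0 a b : 'rV[R]_m) (P : 'M[R]_m) :
  (\forall x \near x0, f x = a + (x - b) *m P) ->
  \forall x \near x0, [/\ differentiable f x, jac f x = P & {for x, continuous (jac f)}].
Proof.
move=> fE; have fP := near_affine_jac fE.
apply: filterS2 (near_join fP) fP => x fx [dfx jfx]; split => //.
by apply: (continuous_jac_near (P := P)); apply: filterS fx => y [].
Qed.

Theorem theorem4p5 (R : realType) (m : nat) (g : 'rV[R]_m -> \bar R)
  (zb lb : 'rV[R]_m) :
  polyhedral_fun g -> subdiff g zb lb ->
  ((rel_int (subdiff g zb) lb <->
      (forall r : R, 0 < r -> C2_near (fun x => fine (moreau r g x)) (zb + r *: lb)))
   /\ (rel_int (subdiff g zb) lb <->
      (forall r : R, 0 < r -> C1_near (prox r g) (zb + r *: lb))))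
  /\
  (rel_int (subdiff g zb) lb -> forall r : R, 0 < r ->
     exists P Q : 'M[R]_m,
       is_proj_mx (crit_cone g zb lb) P /\
       is_proj_mx (crit_cone (conjugate g) lb zb) Q /\
       (\forall x \near zb + r *: lb,
          jac (prox r g) x = P /\
          hess (fun y => fine (moreau r g y)) x = r^-1 *: (1%:M - P)) /\
       r^-1 *: (1%:M - P) = r^-1 *: Q).
Proof.
move=> [g_proper [k [p [c [b epi]]]]] sub_zb.
have epiE x a : (g x <= a%:E)%E <-> forall i, dotp (p i) x + c i * a <= b i.
  by have /= := congr1 (fun S : set _ => S (x, a)) epi; rewrite /epigraph /= => ->.
have /subdiffP[a0 gzb _] := sub_zb.
pose Q := crit_mx p c b zb lb a0.
have [P PP] := exists_orth_proj Q.
have gradE r : 0 < r -> grad (fun y => fine (moreau r g y)) =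
    fun x => r^-1 *: (x - prox r g x).
  by move=> r0; apply/funext => x; have [] := moreau_grad g_proper epiE r0 sub_zb x.
have prox_C1 (ri : rel_int (subdiff g zb) lb) r (r0 : 0 < r) :=
  near_affine_C1 (prox_near g_proper epiE gzb sub_zb PP r0 ri).
have grad_C1 (ri : rel_int (subdiff g zb) lb) r (r0 : 0 < r) :
    \forall x \near zb + r *: lb,
      [/\ differentiable (grad (fun y => fine (moreau r g y))) x,
          hess (fun y => fine (moreau r g y)) x = r^-1 *: (1%:M - P) &
          {for x, continuous (hess (fun y => fine (moreau r g y)))}].
  apply: (@near_affine_C1 _ _ _ _ (r^-1 *: (r *: lb)) (zb + r *: lb)).
  apply: filterS (prox_near g_proper epiE gzb sub_zb PP r0 ri) => x px.
  rewrite gradE // px -scalemxAr mulmxBr mulmx1 -scalerDr; congr (_ *: _).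
  by move: (_ *m P) => u; apply/rowP => j; rewrite !mxE; ring.
(* Both converses go through [r = 1] and the derivative at the center. *)
have prox_ri : differentiable (prox 1 g) (zb + 1 *: lb) -> rel_int (subdiff g zb) lb.
  move=> dp; apply: (row_perp_rel_int g_proper epiE gzb sub_zb PP) => w.
  exact: (differentiable_prox_row_perp g_proper epiE gzb sub_zb ltr01).
split; first split.
- split=> [ri r r0|/(_ 1 ltr01)].
    apply: filterS (grad_C1 ri r r0) => x [dg _ hc]; split => //.
    by have [] := moreau_grad g_proper epiE r0 sub_zb x.
  move=> /nbhs_singleton[_ [dg _]]; apply: prox_ri.
  (* For [r = 1] the gradient formula turns a second derivative of the envelope into a first
     derivative of the prox. *)
  have -> : prox 1 g = id - grad (fun y => fine (moreau 1 g y)).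
    apply/funext => x; rewrite gradE ?ltr01 //.
    by rewrite -[RHS]/(x - 1^-1 *: (x - prox 1 g x)) invr1 scale1r subKr.
  exact: differentiableB.
- split=> [ri r r0|/(_ 1 ltr01)].
    by apply: filterS (prox_C1 ri r r0) => x [dp _ jc].
  by move=> /nbhs_singleton[dp _]; exact: prox_ri.
(* The critical cone of the conjugate is the orthogonal complement of that of [g], whence the
   witness [1 - P]. *)
move=> ri r r0; exists P, (1%:M - P); split; last split; last split => //.
- rewrite (crit_cone_poly g_proper epiE gzb sub_zb).
  suff -> : crit_poly p c b zb lb a0 = row_perp Q by exact: is_proj_mx_perp.
  apply/seteqP; split=> w; first exact: (rel_int_row_perp g_proper epiE gzb sub_zb ri).
  exact: row_perp_crit_poly.
- rewrite (crit_cone_conjugate g_proper epiE gzb sub_zb PP ri).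
  exact: is_proj_mx_span.
- by apply: filterS2 (prox_C1 ri r r0) (grad_C1 ri r r0) => x [_ jp _] [_ hg _].
Qed.
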